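(* Let $T$ be a tree on the vertex set $\{1,\dots,n\}$ with root $r$, let $k\geqslant 3$, let $\Gamma_k$ be a set of $k$ colors, and let $F_1,\dots,F_n$ be fixed strategies on $T$ with color set $\Gamma_k$. Then for every color $c\in \Gamma_k$ which is not dominant for $F_r$, there is a demonic coloring $f$ of $T$ (with respect to $F_1,\dots,F_n$) such that $f(r)=c$. In consequence, every tree $T$ with at least two vertices satisfies $\mu (T)=2$.
   Context: Let $G$ be a finite simple graph on the vertex set $\{1,\dots,n\}$ and let $\Gamma$ be a finite set of colors. A strategy for vertex $i$ is a function $F_i:\Gamma^n\to\Gamma$ whose value $F_i(x_1,\dots,x_n)$ depends only on those coordinates $x_j$ for which $j$ is adjacent to $i$ in $G$. A demonic coloring with respect to strategies $F_1,\dots,F_n$ is an element $(x_1,\dots,x_n)\in\Gamma^n$ (viewed as a coloring $f$ with $f(i)=x_i$) such that $F_i(x_1,\dots,x_n)\neq x_i$ for all $i$. The hat chromatic number $\mu(G)$ is the largest integer $k=|\Gamma|$ for which there exist strategies $F_1,\dots,F_n$ on $G$ admitting no demonic coloring. A cube is a nonempty set of the form $C=C_1\times\dots\times C_n$ with $C_i\subseteq\Gamma_k$; the set $C_i$ is its $i$-th component. For a tree $T$ with root $r$ and a strategy $F_r$ for $r$, a color $d\in\Gamma_k$ is dominant for $F_r$ if $F_r^{-1}(d)\subseteq\Gamma_k^n$ contains a cube each of whose components has size at least $k-1$. *)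

(* Defs.v *)
From HB Require Import structures.
From mathcomp Require Import all_boot.

Set Implicit Arguments.
Unset Strict Implicit.
Unset Printing Implicit Defensive.

Record sgraph (n : nat) := SGraph {
  adj :> rel 'I_n;
  adj_sym : symmetric adj;
  adj_irrefl : irreflexive adj }.

Definition connected_graph n (G : sgraph n) : Prop :=
  forall u v : 'I_n, connect G u v.

(* [ucycle G p] also holds for [:: u; v] with u adjacent to v, hence the
   length requirement. *)
Definition acyclic_graph n (G : sgraph n) : Prop :=
  forall p : seq 'I_n, 2 < size p -> ~ ucycle G p.

Definition is_tree n (G : sgraph n) : Prop :=
  [/\ 0 < n, connected_graph G & acyclic_graph G].

Definition coloring (n : nat) (Gamma : finType) := {ffun 'I_n -> Gamma}.

Definition is_strategy n (G : sgraph n) (Gamma : finType) (i : 'I_n)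
    (Fi : coloring n Gamma -> Gamma) : Prop :=
  forall x y : coloring n Gamma, (forall j, G i j -> x j = y j) -> Fi x = Fi y.

Definition demonic n (Gamma : finType)
    (F : 'I_n -> coloring n Gamma -> Gamma) (x : coloring n Gamma) : Prop :=
  forall i, F i x <> x i.

Definition has_undefeated_strategies n (G : sgraph n) (Gamma : finType) : Prop :=
  exists F : 'I_n -> coloring n Gamma -> Gamma,
    (forall i, is_strategy G i (F i)) /\ ~ (exists x, demonic F x).

(* Stated as a relation: for the graph without vertices no such maximum
   exists, as its unique coloring is always demonic. *)
Definition hat_chromatic_number_is n (G : sgraph n) (m : nat) : Prop :=
  (exists Gamma : finType, #|Gamma| = m /\ has_undefeated_strategies G Gamma) /\
  (forall Gamma : finType, has_undefeated_strategies G Gamma -> #|Gamma| <= m).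

Definition prod_set n (Gamma : finType) (C : 'I_n -> {set Gamma}) :
    {set coloring n Gamma} := [set x in family C].

Definition is_cube n (Gamma : finType) (C : 'I_n -> {set Gamma}) : Prop :=
  prod_set C != set0.

Definition dominant n (Gamma : finType)
    (Fr : coloring n Gamma -> Gamma) (d : Gamma) : Prop :=
  exists C : 'I_n -> {set Gamma},
    [/\ is_cube C, forall i, #|Gamma| - 1 <= #|C i|
      & prod_set C \subset Fr @^-1: [set d]].

(* Main.v *)
Require Import Defs.
From HB Require Import structures.
From mathcomp Require Import all_boot.

(** Color the tree level by level, starting from the root. For [#|Gamma| >= 3]
    two cubes with components of size at least [#|Gamma| - 1] meet, so a function
    has at most one dominant color. Keep the invariant that every vertex [v] of
    the current level has a color which is not dominant for [F v] once the colors
    of the lower levels are fixed. The non-dominant colors of the vertices of the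
    next level are the components of a cube with components of size at least
    [#|Gamma| - 1], hence [v] can be made to guess wrong by colors of its children
    taken in this cube; the children of distinct vertices are distinct. *)

Set Implicit Arguments.
Unset Strict Implicit.
Unset Printing Implicit Defensive.

(** * Distance from the root in a tree *)

Section Distance.

Variables (n : nat) (T : sgraph n) (r : 'I_n).
Hypothesis connT : connected_graph T.

(** Tuples of a fixed length form a finite type, which gives [ex_minn] the boolean predicate it
    needs. *)
Lemma exists_path_size (v : 'I_n) :
  exists m, [exists p : m.-tuple 'I_n, path T r p && (v == last r p)].
Proof.
have /connectP[p pp ->] := connT r v.
by exists (size p); apply/existsP; exists (in_tuple p); rewrite pp eqxx.
Qed.

Definition dist (v : 'I_n) : nat := ex_minn (exists_path_size v).

Lemma dist_path (v : 'I_n) :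
  exists p, [/\ path T r p, v = last r p & size p = dist v].
Proof.
rewrite /dist; case: ex_minnP => m /existsP[p /andP[pp /eqP ->]] _.
by exists p; rewrite size_tuple.
Qed.

Lemma dist_le_size (p : seq 'I_n) : path T r p -> dist (last r p) <= size p.
Proof.
move=> pp; rewrite /dist; case: ex_minnP => m _; apply.
by apply/existsP; exists (in_tuple p); rewrite pp eqxx.
Qed.

Lemma dist_root : dist r = 0.
Proof. by apply/eqP; rewrite -leqn0; apply: (@dist_le_size [::]). Qed.

Lemma dist_eq0 (v : 'I_n) : dist v = 0 -> v = r.
Proof. by have [p [_ -> <-]] := dist_path v; move/size0nil->. Qed.

Lemma dist_adj (u v : 'I_n) : T u v -> dist v <= (dist u).+1.
Proof.
have [p [pp up <-]] := dist_path u => Tuv.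
have := @dist_le_size (rcons p v); rewrite last_rcons size_rcons; apply.
by rewrite rcons_path pp -up.
Qed.

Lemma dist_pred (v : 'I_n) : v != r -> exists2 u, T u v & dist u < dist v.
Proof.
have [p [pp vp <-]] := dist_path v.
case/lastP: p pp vp => [_ -> /eqP //|p w].
rewrite rcons_path last_rcons size_rcons => /andP[pp Tw] -> _.
by exists (last r p) => //; rewrite ltnS dist_le_size.
Qed.

Definition avoid (v : 'I_n) : rel 'I_n :=
  [rel x y | [&& T x y, x != v & y != v]].

(** Walk from [u] to [r] through ever closer vertices: all of them after [u] are strictly closer to
    [r] than [v]. *)
Lemma connect_avoid (v u : 'I_n) :
  u != v -> dist u <= dist v -> connect (avoid v) r u.
Proof.
have [m] := ubnP (dist u); elim: m u => // m IH u; rewrite ltnS => um uv duv.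
have [-> //|ur] := eqVneq u r.
have [w Twu dw] := dist_pred ur.
have wv : w != v by apply: contraTneq (leq_trans dw duv) => ->; rewrite ltnn.
apply: (connect_trans (IH w (leq_trans dw um) wv (ltnW (leq_trans dw duv)))).
by apply: connect1; rewrite /avoid /= Twu wv uv.
Qed.

Hypothesis acycT : acyclic_graph T.

(** Otherwise a simple path from [u] to [w] off [v] would close up through [v] to a cycle. *)
Lemma connect_avoid_eq (v u w : 'I_n) :
  T v u -> T v w -> connect (avoid v) u w -> u = w.
Proof.
move=> Tvu Tvw /connectP[p pp wp]; rewrite {w}wp in Tvw *.
case/shortenP: pp Tvw => [[|x q] //= pq uq _ Tvw].
have vn : v \notin u :: x :: q.
  have : all (fun y => y != v) (u :: x :: q).
    have /= /andP[/and3P[_ -> _] _] := pq.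
    elim: q x u {Tvu Tvw uq} pq => [|y q IH] x u /= /andP[/and3P[_ _ ->]] //.
    exact: IH.
  by move=> /allP a; apply/negP => /a; rewrite eqxx.
case: (@acycT [:: v, u, x & q] isT); apply/andP; split; last exact/andP.
rewrite /= Tvu rcons_path /= [T _ v]adj_sym Tvw andbT.
by apply: (@sub_path _ (avoid v) T _ u (x :: q)) => // a b /and3P[].
Qed.

(** Both neighbors are joined to [r] off [v], hence to each other. The bounds are not strict so that
    edges inside a level can be excluded next. *)
Lemma dist_lower_unique (v u w : 'I_n) :
  T v u -> T v w -> dist u <= dist v -> dist w <= dist v -> u = w.
Proof.
have neq x : T v x -> x != v.
  by apply: contraTneq => ->; rewrite adj_irrefl.
move=> Tu Tw du dw; apply: (connect_avoid_eq Tu Tw).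
apply: connect_trans (connect_avoid (neq w Tw) dw).
rewrite (@sym_connect_sym _ (avoid v)) ?connect_avoid ?neq // => x y; rewrite /avoid /=.
by rewrite adj_sym; congr (_ && _); rewrite andbC.
Qed.

Lemma dist_adj_neq (u v : 'I_n) : T u v -> dist u != dist v.
Proof.
move=> Tuv; apply/eqP => duv.
have vr : v != r.
  apply: contraTneq Tuv => vr; move: duv; rewrite vr dist_root => /dist_eq0->.
  by rewrite adj_irrefl.
have [w Twv dw] := dist_pred vr.
have uw : u = w.
  by apply: (@dist_lower_unique v); rewrite 1?adj_sym ?duv // ltnW.
by rewrite -uw duv ltnn in dw.
Qed.

Lemma dist_adj_cases (u v : 'I_n) :
  T u v -> (dist v == (dist u).+1) || (dist u == (dist v).+1).
Proof.
move=> Tuv; have duv := dist_adj Tuv.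
have dvu : dist u <= (dist v).+1 by apply: dist_adj; rewrite adj_sym.
by have := dist_adj_neq Tuv; rewrite neq_ltn !eqn_leq duv dvu.
Qed.

End Distance.

(** * Dominant colors *)

Section Dominant.

Variables (n : nat) (Gamma : finType).
Implicit Types (f : coloring n Gamma -> Gamma) (C : 'I_n -> {set Gamma}).

Lemma prod_set_neq0 C : (forall i, C i != set0) -> prod_set C != set0.
Proof.
move=> C0; have /fin_all_exists[x xC] : forall i, exists c, c \in C i.
  by move=> i; apply/set0Pn.
apply/set0Pn; exists [ffun i => x i].
by rewrite inE; apply/familyP => i; rewrite ffunE.
Qed.

Definition dominantb f (d : Gamma) : bool :=
  [exists C : {ffun 'I_n -> {set Gamma}},
    [&& prod_set C != set0, [forall i, #|Gamma| - 1 <= #|C i|]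
      & prod_set C \subset f @^-1: [set d]]].

Lemma dominantP f d : reflect (dominant f d) (dominantb f d).
Proof.
apply: (iffP existsP) => [[C /and3P[C0 /forallP Ck sC]]|[C [C0 Ck sC]]].
  by exists C.
have E : prod_set (finfun C) = prod_set C.
  apply/setP => x; rewrite !inE.
  by apply/familyP/familyP => xC i; have := xC i; rewrite ffunE.
exists (finfun C); rewrite E; apply/and3P; split=> //.
by apply/forallP => i; rewrite ffunE.
Qed.

Lemma eq_dominant f g d : f =1 g -> dominant f d -> dominant g d.
Proof.
move=> fg [C [C0 Ck sC]]; exists C; split=> //.
by apply: subset_trans sC _; apply/subsetP => x; rewrite !inE fg.
Qed.

Hypothesis Gamma_ge3 : 3 <= #|Gamma|.

Lemma dominant_unique f d e : dominant f d -> dominant f e -> d = e.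
Proof.
move=> [C [_ Ck sC]] [D [_ Dk sD]].
have : prod_set (fun i => C i :&: D i) != set0.
  apply: prod_set_neq0 => i; rewrite -card_gt0.
  (* With [k] colors, the intersection has size at least [2(k - 1) - k = k - 2 > 0]. *)
  have := leq_add (Ck i) (Dk i); rewrite -cardsUI => le.
  have := leq_trans le (leq_add (max_card _) (leqnn _)).
  by move: Gamma_ge3; case: #|Gamma| => [|[|[|k]]] // _;
     rewrite subn1 addnS -addSn leq_add2l; apply: leq_trans.
case/set0Pn=> x; rewrite inE => /familyP xCD.
have /(subsetP sC) : x \in prod_set C.
  by rewrite inE; apply/familyP => i; have := xCD i; rewrite inE => /andP[].
have /(subsetP sD) : x \in prod_set D.
  by rewrite inE; apply/familyP => i; have := xCD i; rewrite inE => /andP[].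
by rewrite !inE => /eqP-> /eqP->.
Qed.

Definition nondominant f : {set Gamma} := [set d | ~~ dominantb f d].

Lemma card_nondominant f : #|Gamma| - 1 <= #|nondominant f|.
Proof.
have -> : nondominant f = ~: [set d | dominantb f d].
  by apply/setP => d; rewrite !inE.
rewrite cardsCs setCK leq_sub2l //.
apply/card_le1_eqP => d e; rewrite !inE => /dominantP dd /dominantP de.
exact: (dominant_unique de dd).
Qed.

Lemma nondominant_neq0 f : nondominant f != set0.
Proof.
rewrite -card_gt0; apply: leq_trans (card_nondominant f).
by rewrite subn_gt0 ltnW.
Qed.

(** If [f] were constantly [c] on the cube, this cube would witness that [c] is dominant. *)
Lemma nondominant_avoid f c C :
  (forall i, #|Gamma| - 1 <= #|C i|) -> c \in nondominant f ->
  exists2 y : coloring n Gamma, forall i, y i \in C i & f y <> c.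
Proof.
rewrite inE => Ck /dominantP ndc.
have C0 : is_cube C.
  apply: prod_set_neq0 => i; rewrite -card_gt0; apply: leq_trans (Ck i).
  by rewrite subn_gt0 ltnW.
have /subsetPn[y] : ~~ (prod_set C \subset f @^-1: [set c]).
  by apply/negP => sC; apply: ndc; exists C.
by rewrite !inE => /familyP yC /eqP fy; exists y.
Qed.

End Dominant.

(** * Coloring the tree level by level *)

Section LevelByLevel.

Variables (n : nat) (T : sgraph n) (Gamma : finType).
Variable F : 'I_n -> coloring n Gamma -> Gamma.
Hypothesis treeT : is_tree T.
Hypothesis stratF : forall i, is_strategy T i (F i).
Hypothesis Gamma_ge3 : 3 <= #|Gamma|.
Variable r : 'I_n.

Let connT : connected_graph T. Proof. by case: treeT. Qed.
Let acycT : acyclic_graph T. Proof. by case: treeT. Qed.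
Let dep := dist r connT.

(** The result still takes full colorings, so that [dominant] applies to it unchanged. *)
Definition fix_below (x : coloring n Gamma) (v : 'I_n) :
    coloring n Gamma -> Gamma :=
  fun y => F v [ffun j => if dep j < dep v then x j else y j].

(** For strategies on the tree, the values of [x] at depth above [m] are mere placeholders: neither
    clause depends on them. *)
Definition demonic_below (m : nat) (x : coloring n Gamma) : Prop :=
  (forall v, dep v < m -> F v x <> x v) /\
  (forall v, dep v = m -> x v \in nondominant (fix_below x v)).

Lemma demonic_below_step m x :
  demonic_below m x -> exists2 x', demonic_below m.+1 x' & x' r = x r.
Proof.
move=> [dem nd].
pose C j := nondominant (fix_below x j).
have Ck j : #|Gamma| - 1 <= #|C j| by exact: card_nondominant.
have /fin_all_exists[y yP] : forall v, exists y : coloring n Gamma,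
    (forall j, y j \in C j) /\ (dep v = m -> fix_below x v y <> x v).
  move=> v; have [dv|dv] := eqVneq (dep v) m.
    by have [y yC yx] := nondominant_avoid Gamma_ge3 Ck (nd v dv); exists y.
  have /set0Pn[y] : prod_set C != set0.
    by apply: prod_set_neq0 => j; apply: nondominant_neq0.
  by rewrite inE => /familyP yC; exists y; split=> // /eqP; rewrite (negPf dv).
(* The parent of [w]; the default [w] is taken only at the root. *)
pose par w := odflt w [pick u | T w u && (dep u < dep w)].
have parE v w : T v w -> dep v < dep w -> par w = v.
  rewrite adj_sym /par => Twv dvw; case: pickP => [u /andP[Twu du]|/(_ v)] /=.
    exact: (dist_lower_unique acycT Twu Twv (ltnW du) (ltnW dvw)).
  by rewrite Twv dvw.
pose x' : coloring n Gamma :=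
  [ffun j => if dep j == m.+1 then y (par j) j else x j].
have x'E j : dep j <= m -> x' j = x j.
  by move=> dj; rewrite ffunE ltn_eqF.
exists x'; last by rewrite x'E // /dep dist_root.
split=> v.
  rewrite ltnS leq_eqVlt => /orP[/eqP dv|dv].
    (* A neighbor of [v] is either its parent, which keeps its color, or a child, whose new color
       comes from [y v]; so [F v x'] is the wrong guess [fix_below x v (y v)]. *)
    rewrite x'E ?dv //; have [_ /(_ dv)] := yP v.
    congr (_ <> _); apply: stratF => j Tvj; rewrite !ffunE.
    have [/eqP dj|/eqP dj] := orP (dist_adj_cases r connT acycT Tvj);
      rewrite -/dep in dj.
      by rewrite dj dv eqxx ltnNge leqnSn /= (parE v) // dj.
    by rewrite -dv dj ltnSn ltn_eqF // ltnW.
  rewrite x'E ?(ltnW dv) //.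
  suff -> : F v x' = F v x by exact: dem.
  by apply: stratF => j /(dist_adj r connT) dj; rewrite x'E // (leq_trans dj).
move=> dv; rewrite {1}/x' ffunE dv eqxx.
(* Every [y u] lies in the cube [C], so the new color of [v] is in [C v]; [x'] and [x] agree below
   [v], so they give the same non-dominant colors. *)
have [/(_ v) + _] := yP (par v); rewrite /C !inE.
apply: contraNN => /dominantP dom; apply/dominantP.
apply: eq_dominant dom => z; rewrite /fix_below.
congr (F v _); apply/ffunP => j.
by rewrite [LHS]ffunE [RHS]ffunE dv ltnS; case: leqP => // /x'E.
Qed.

Lemma exists_demonic (c : Gamma) :
  ~ dominant (F r) c -> exists f : coloring n Gamma, demonic F f /\ f r = c.
Proof.
move=> ndc.
have dem m : exists2 x, demonic_below m x & x r = c.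
  elim: m => [|m [x /demonic_below_step[x' dx' <-] <-]]; last by exists x'.
  (* Only the root has depth 0, and nothing lies below it, so [fix_below] is [F r] there. *)
  exists [ffun=> c]; last by rewrite ffunE.
  split=> // v /(dist_eq0 (connT := connT)) ->; rewrite ffunE inE.
  apply/dominantP => dom; apply: ndc; apply: eq_dominant dom => z.
  rewrite /fix_below; congr (F r _); apply/ffunP => j.
  by rewrite ffunE /dep dist_root.
have [x [dx _] xr] := dem (\max_v dep v).+1.
by exists x; split=> // v; apply: dx; rewrite ltnS leq_bigmax.
Qed.

End LevelByLevel.

(** One end of an edge guesses that the two ends agree, the other that they
    differ. *)
Lemma edge_undefeated (n : nat) (G : sgraph n) (u v : 'I_n) :
  G u v -> has_undefeated_strategies G bool.
Proof.
move=> Guv; have uv : v != u by apply: contraTneq Guv => ->; rewrite adj_irrefl.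
exists (fun i x => if i == u then x v else if i == v then ~~ x u else true).
split=> [i x y xy|[x dx]].
  case: (i =P u) => [iu|_]; first by apply: xy; rewrite iu.
  by case: (i =P v) => [iv|//]; rewrite xy // iv adj_sym.
by have := dx u; have := dx v; rewrite !eqxx (negPf uv); case: (x u); case: (x v).
Qed.

Lemma connected_adj (n : nat) (G : sgraph n) (u v : 'I_n) :
  connected_graph G -> u != v -> exists w, G u w.
Proof.
move=> /(_ u v) /connectP[[|w p] /=]; first by move=> _ ->; rewrite eqxx.
by case/andP=> Guw _ _ _; exists w.
Qed.

Theorem theorem4 (n : nat) (T : sgraph n) (hT : is_tree T) :
  (forall (r : 'I_n) (k : nat) (Gamma : finType)
          (F : 'I_n -> coloring n Gamma -> Gamma),
     3 <= k -> #|Gamma| = k ->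
     (forall i, is_strategy T i (F i)) ->
     forall c : Gamma, ~ dominant (F r) c ->
     exists f : coloring n Gamma, demonic F f /\ f r = c)
  /\ (2 <= n -> hat_chromatic_number_is T 2).
Proof.
split=> [r k Gamma F k3 Gk stratF c|n2].
  by apply: exists_demonic hT stratF _ _ _; rewrite Gk.
have [n0 connT _] := hT; split.
  exists bool; split; first exact: card_bool.
  have [w Tw] : exists w, T (Ordinal n0) w.
    exact: (@connected_adj _ _ _ (Ordinal n2) connT).
  exact: edge_undefeated Tw.
move=> Gamma [F [stratF nd]]; case: (leqP #|Gamma| 2) => // G3.
(* With three or more colors, any vertex taken as root has a non-dominant color, which extends to a
   demonic coloring. *)
have /set0Pn[c] := nondominant_neq0 G3 (F (Ordinal n0)).
rewrite inE => /dominantP /(exists_demonic hT stratF G3)[f [df _]].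
by case: nd; exists f.
Qed.
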